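(* Let $J\in\mathbb{C}^{2\times2}$ be unitary, with associated coefficients $\omega_\pm$, $\mu_\pm^{(x,y)}$, $\mu_0^{(x,y)}$ and Green's function $G$ (defined in the context). For every $k\in\mathbb{R}$ the solution $\Psi(t,x;e^{ik\,\cdot\,})=\int_{\mathbb{R}}G(t,x,y)e^{iky}\,dy$ of the Schrödinger equation with generalized point interaction given by $J$ and initial condition $F(x)=e^{ikx}$ is, for $t>0$ and $x\in\mathbb{R}\setminus\{0\}$, $$\begin{aligned}\Psi(t,x;e^{ik\,\cdot\,})=&\left(\frac{\mu_+^{(x,0^+)}}{\omega_++ik}+\frac{\mu_-^{(x,0^+)}}{\omega_-+ik}+\frac{\mu_0^{(x,0^+)}}{2}\right)e^{-\frac{x^2}{4it}}\Lambda\Big(\frac{|x|}{2\sqrt{it}}-ik\sqrt{it}\Big)\\&+\left(\frac{\mu_+^{(x,0^-)}}{\omega_+-ik}+\frac{\mu_-^{(x,0^-)}}{\omega_--ik}+\frac{\mu_0^{(x,0^-)}}{2}\right)e^{-\frac{x^2}{4it}}\Lambda\Big(\frac{|x|}{2\sqrt{it}}+ik\sqrt{it}\Big)\\&-\sum_{j=\pm}\left(\frac{\mu_j^{(x,0^-)}}{\omega_j-ik}+\frac{\mu_j^{(x,0^+)}}{\omega_j+ik}\right)e^{-\frac{x^2}{4it}}\Lambda\Big(\frac{|x|}{2\sqrt{it}}+\omega_j\sqrt{it}\Big)+e^{ikx-ik^2t}.\end{aligned}$$ In the special case $k=0$ this formula is understood in the sense that $\mu_j^{(x,0^\pm)}/\omega_j=0$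 whenever $\omega_j=0$.
   Context: Conventions: for $t>0$, $\sqrt{it}=e^{i\pi/4}\sqrt t$ and $\sqrt{i\pi t}=e^{i\pi/4}\sqrt{\pi t}$ (principal branch); $\Theta(x)=1$ for $x>0$ and $\Theta(x)=0$ for $x<0$. The entire function $\Lambda$ is $\Lambda(z)=e^{z^2}(1-\operatorname{erf}(z))$, where $\operatorname{erf}(z)=\frac{2}{\sqrt\pi}\int_0^z e^{-\xi^2}d\xi$. Coefficients. Every unitary $J\in\mathbb{C}^{2\times2}$ has the form $J=e^{i\phi}\begin{pmatrix}\alpha&-\bar\beta\\ \beta&\bar\alpha\end{pmatrix}$ with $\phi\in[0,\pi)$, $\alpha,\beta\in\mathbb{C}$ and $|\alpha|^2+|\beta|^2=1$. For $x,y\in\mathbb{R}\setminus\{0\}$ put $\eta^{(x,y)}=0$ if $|\operatorname{Re}(\alpha)|=1$, and if $|\operatorname{Re}(\alpha)|\neq1$ put $$\eta^{(x,y)}=\frac{1}{\sqrt{1-\operatorname{Re}(\alpha)^2}}\cdot\begin{cases}-\operatorname{Im}(\alpha),&x,y>0,\\ -i\bar\beta,&x>0,\,y<0,\\ i\beta,&x<0,\,y>0,\\ \operatorname{Im}(\alpha),&x,y<0.\end{cases}$$ Case I: if $\operatorname{Re}(\alpha)\neq-\cos(\phi)$, then $\omega_\pm=\frac{-\sin(\phi)\pm\sqrt{1-\operatorname{Re}(\alpha)^2}}{\cos(\phi)+\operatorname{Re}(\alpha)}$, $\mu_\pm^{(x,y)}=-\frac{\omega_\pm}{2}\big(\Theta(xy)\pm\eta^{(x,y)}\big)$,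 $\mu_0^{(x,y)}=\operatorname{sgn}(xy)$. Case II: if $\operatorname{Re}(\alpha)=-\cos(\phi)\neq-1$, then $\omega_-=\mu_-^{(x,y)}=0$, $\omega_+=\cot(\phi)$, $\mu_+^{(x,y)}=-\frac{\omega_+}{2}\big(\Theta(xy)+\eta^{(x,y)}\big)$, $\mu_0^{(x,y)}=\eta^{(x,y)}-\Theta(-xy)$. Case III: if $\operatorname{Re}(\alpha)=-\cos(\phi)=-1$, then $\omega_\pm=\mu_\pm^{(x,y)}=0$ and $\mu_0^{(x,y)}=-1$. These coefficients depend on $x,y$ only through their signs; $\mu_j^{(x,0^+)}$ (resp. $\mu_j^{(x,0^-)}$), $j\in\{0,+,-\}$, denotes the value of $\mu_j^{(x,y)}$ for $y>0$ (resp. $y<0$). Green's function: for $t>0$, $x,y\in\mathbb{R}\setminus\{0\}$, $$G(t,x,y)=\Big(\mu_+^{(x,y)}\Lambda\Big(\tfrac{|x|+|y|}{2\sqrt{it}}+\omega_+\sqrt{it}\Big)+\mu_-^{(x,y)}\Lambda\Big(\tfrac{|x|+|y|}{2\sqrt{it}}+\omega_-\sqrt{it}\Big)\Big)e^{-\frac{(|x|+|y|)^2}{4it}}+\frac{1}{2\sqrt{i\pi t}}\Big(\mu_0^{(x,y)}e^{-\frac{(|x|+|y|)^2}{4it}}+e^{-\frac{(x-y)^2}{4it}}\Big).$$ Solution: ''the solution'' with initial condition $F$ means $$\Psi(t,x;F)=\int_{\mathbb{R}}G(t,x,y)F(y)\,dy:=\lim_{R_1\to\infty}\int_{-R_1}^0G(t,x,y)F(y)\,dy+\lim_{R_2\to\infty}\int_0^{R_2}G(t,x,y)F(y)\,dy$$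 (improper Riemann integrals, which exist for $F(y)=e^{iky}$); it solves $i\partial_t\Psi=-\partial_x^2\Psi$ for $t>0$, $x\neq0$, with $(I-J)(\Psi(t,0^+),\Psi(t,0^-))^T=i(I+J)(\partial_x\Psi(t,0^+),-\partial_x\Psi(t,0^-))^T$ and $\Psi(0^+,x)=F(x)$. *)

(* Defs.v *)
From Stdlib Require Import Reals Lra.
From Coquelicot Require Import Coquelicot.

Open Scope C_scope.

Definition Cexp (z : C) : C := (exp (Re z) * cos (Im z), exp (Re z) * sin (Im z))%R.

(* The complex integral from 0 to z is taken along the straight segment
   s |-> s z, 0 <= s <= 1; the integrand is entire, so the path is irrelevant. *)
Definition Cerf (z : C) : C :=
  RtoC (2 / sqrt PI) *
  (z * RInt (V := C_R_CompleteNormedModule)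
         (fun s : R => Cexp (- (RtoC s * z) ^ 2)) 0 1).

Definition Lambda (z : C) : C := Cexp (z ^ 2) * (1 - Cerf z).

(* Principal branch of sqrt (i t), for t > 0. *)
Definition Csqrt_i (t : R) : C := Cexp (Ci * RtoC (PI / 4)) * RtoC (sqrt t).

Definition Theta (x : R) : R := if Rlt_dec 0 x then 1%R else 0%R.

Definition unitary2 (J : @matrix C 2 2) : Prop :=
  Mmult (mk_matrix 2 2 (fun i j => Cconj (coeff_mat (RtoC 0) J j i))) J = Mone.

(* The parametrization of unitary 2x2 matrices from which all coefficients are
   computed; see [unitary2_param_ex] and [unitary2_param_inj]. *)
Definition unitary2_param (J : @matrix C 2 2) (phi : R) (alpha beta : C) : Prop :=
  (0 <= phi < PI)%R /\
  (Cmod alpha ^ 2 + Cmod beta ^ 2 = 1)%R /\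
  coeff_mat (RtoC 0) J 0 0 = Cexp (Ci * RtoC phi) * alpha /\
  coeff_mat (RtoC 0) J 0 1 = Cexp (Ci * RtoC phi) * - Cconj beta /\
  coeff_mat (RtoC 0) J 1 0 = Cexp (Ci * RtoC phi) * beta /\
  coeff_mat (RtoC 0) J 1 1 = Cexp (Ci * RtoC phi) * Cconj alpha.

Inductive pm : Set := Plus | Minus.

Definition pm_val (s : pm) : R := match s with Plus => 1%R | Minus => (-1)%R end.

(* As for [mu] and [mu0] below, only the signs of the nonzero reals x, y matter. *)
Definition eta (alpha beta : C) (x y : R) : C :=
  if Req_dec_T (Rabs (Re alpha)) 1 then 0
  else
    RtoC (1 / sqrt (1 - Re alpha ^ 2)) *
    (if Rlt_dec 0 x then
       if Rlt_dec 0 y then RtoC (- Im alpha) else - Ci * Cconj beta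
     else
       if Rlt_dec 0 y then Ci * beta else RtoC (Im alpha)).

(* In the next three definitions the branches are, in this order, the cases
   Re alpha = - cos phi = -1, then Re alpha = - cos phi <> -1, and finally
   Re alpha <> - cos phi. *)
Definition omega (s : pm) (phi : R) (alpha : C) : R :=
  if Req_dec_T (Re alpha) (- cos phi) then
    if Req_dec_T (Re alpha) (-1) then 0%R
    else match s with Plus => (cos phi / sin phi)%R | Minus => 0%R end
  else
    ((- sin phi + pm_val s * sqrt (1 - Re alpha ^ 2)) / (cos phi + Re alpha))%R.

Definition mu (s : pm) (phi : R) (alpha beta : C) (x y : R) : C :=
  if Req_dec_T (Re alpha) (- cos phi) then
    if Req_dec_T (Re alpha) (-1) then 0
    else
      match s with
      | Plus =>
          - (RtoC (omega Plus phi alpha) / 2) *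
            (RtoC (Theta (x * y)) + eta alpha beta x y)
      | Minus => 0
      end
  else
    - (RtoC (omega s phi alpha) / 2) *
      (RtoC (Theta (x * y)) + RtoC (pm_val s) * eta alpha beta x y).

Definition mu0 (phi : R) (alpha beta : C) (x y : R) : C :=
  if Req_dec_T (Re alpha) (- cos phi) then
    if Req_dec_T (Re alpha) (-1) then RtoC (-1)
    else eta alpha beta x y - RtoC (Theta (- (x * y)))
  else RtoC (sign (x * y)).

Definition Green (phi : R) (alpha beta : C) (t x y : R) : C :=
  let r := (Rabs x + Rabs y)%R in
  let s := Csqrt_i t in
  let E := Cexp (- (RtoC r ^ 2 / (4 * Ci * RtoC t))) in
  (mu Plus phi alpha beta x y *
     Lambda (RtoC r / (2 * s) + RtoC (omega Plus phi alpha) * s) +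
   mu Minus phi alpha beta x y *
     Lambda (RtoC r / (2 * s) + RtoC (omega Minus phi alpha) * s)) * E +
  1 / (2 * Csqrt_i (PI * t)) *
  (mu0 phi alpha beta x y * E +
   Cexp (- (RtoC (x - y) ^ 2 / (4 * Ci * RtoC t)))).

(* Psi(t, x; F) = v: both improper Riemann integrals, over (-oo, 0) and over
   (0, +oo), exist, and v is their sum.  The value of [Green] at y = 0 has no
   meaning, but does not influence the integrals. *)
Definition is_Psi (phi : R) (alpha beta : C) (F : R -> C) (t x : R) (v : C) : Prop :=
  exists I1 I2 : C,
    is_RInt_gen (V := C_R_NormedModule)
      (fun y : R => Green phi alpha beta t x y * F y)
      (Rbar_locally m_infty) (at_point 0%R) I1 /\
    is_RInt_gen (V := C_R_NormedModule)
      (fun y : R => Green phi alpha beta t x y * F y)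
      (at_point 0%R) (Rbar_locally p_infty) I2 /\
    v = I1 + I2.

(* Division by zero yields zero, which is the convention mu_j / omega_j = 0
   for omega_j = 0 needed in the case k = 0. *)
Lemma Cdiv_0_r (z : C) : z / 0 = 0.
Proof.
unfold Cdiv, Cinv; simpl.
apply injective_projections; simpl; unfold Rdiv; ring.
Qed.

Lemma unit_circle_angle (a b : R) : (a ^ 2 + b ^ 2 = 1)%R ->
  exists th : R, (0 <= th < 2 * PI)%R /\ cos th = a /\ sin th = b.
Proof.
intros H.
assert (Ha : (-1 <= a <= 1)%R) by nra.
assert (HP := PI_RGT_0).
assert (Hb := acos_bound a).
assert (Hs : sin (acos a) = Rabs b).
{ rewrite sin_acos by lra. rewrite <- sqrt_Rsqr_abs. f_equal. unfold Rsqr. nra. }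
destruct (Rle_dec 0 b) as [b0|b0].
- exists (acos a). rewrite cos_acos, Hs, Rabs_pos_eq by lra.
  repeat split; lra.
- assert (a <> (-1))%R by (intros ->; nra).
  assert (acos a <> 0)%R.
  { intros E. rewrite E, sin_0 in Hs. rewrite Rabs_left in Hs; lra. }
  exists (2 * PI - acos a)%R.
  rewrite cos_minus, sin_minus, cos_2PI, sin_2PI, cos_acos, Hs by lra.
  rewrite Rabs_left by lra. repeat split; lra.
Qed.

Lemma Cexp_Ci (x : R) : Cexp (Ci * RtoC x) = (cos x, sin x).
Proof.
unfold Cexp; simpl.
replace (0 * x - 1 * 0)%R with 0%R by ring.
replace (0 * 0 + 1 * x)%R with x by ring.
rewrite exp_0. f_equal; ring.
Qed.

Lemma Cexp_Ci_conj (x : R) : Cexp (Ci * RtoC x) * Cconj (Cexp (Ci * RtoC x)) = 1.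
Proof.
rewrite Cexp_Ci; apply injective_projections; simpl; try ring.
assert (H := sin2_cos2 x); unfold Rsqr in H; lra.
Qed.

Lemma Cmod2_conj1 (a b : C) :
  (Cmod a ^ 2 + Cmod b ^ 2 = 1)%R <-> a * Cconj a + b * Cconj b = 1.
Proof.
rewrite <- !Cmod2_conj, <- RtoC_plus.
split; [intros -> | intros H; apply RtoC_inj]; easy.
Qed.

Lemma unitary2_param_ex (J : @matrix C 2 2) : unitary2 J ->
  exists (phi : R) (alpha beta : C), unitary2_param J phi alpha beta.
Proof.
intros H; unfold unitary2 in H.
assert (H00 := f_equal (fun M => coeff_mat (zero : C_Ring) M 0 0) H).
assert (H01 := f_equal (fun M => coeff_mat (zero : C_Ring) M 0 1) H).
assert (H11 := f_equal (fun M => coeff_mat (zero : C_Ring) M 1 1) H).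
clear H; unfold Mmult, Mone in H00, H01, H11.
rewrite !coeff_mat_bij in H00, H01, H11 by auto.
simpl pred in H00, H01, H11.
rewrite sum_Sn, sum_O, !coeff_mat_bij in H00, H01, H11 by auto.
change (@zero C_Ring) with (RtoC 0) in H00, H01, H11.
unfold unitary2_param.
set (a := coeff_mat (RtoC 0) J 0 0) in *.
set (b := coeff_mat (RtoC 0) J 0 1) in *.
set (c := coeff_mat (RtoC 0) J 1 0) in *.
set (d := coeff_mat (RtoC 0) J 1 1) in *.
change (Cconj a * a + Cconj c * c = 1) in H00.
change (Cconj a * b + Cconj c * d = 0) in H01.
change (Cconj b * b + Cconj d * d = 1) in H11.
set (D := a * d - b * c).
assert (Hd : d = D * Cconj a).
{ transitivity (d * (Cconj a * a + Cconj c * c) - c * (Cconj a * b + Cconj c * d)).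
  - rewrite H00, H01; ring.
  - unfold D; ring. }
assert (Hb : b = - (D * Cconj c)).
{ transitivity (b * (Cconj a * a + Cconj c * c) - a * (Cconj a * b + Cconj c * d)).
  - rewrite H00, H01; ring.
  - unfold D; ring. }
assert (HD : D * Cconj D = 1).
{ rewrite <- H11.
  transitivity (D * Cconj D * (Cconj a * a + Cconj c * c)).
  - rewrite H00; ring.
  - rewrite Hd, Hb, ?Copp_conj, ?Cmult_conj, ?Cconj_conj; ring. }
clearbody D.
destruct (unit_circle_angle (Re D) (Im D)) as (th & Hth & Hc & Hs).
{ rewrite <- Cmod2_alt. apply RtoC_inj. rewrite Cmod2_conj. exact HD. }
exists (th / 2)%R.
set (e := Cexp (Ci * RtoC (th / 2))).
assert (He : e * Cconj e = 1) by apply Cexp_Ci_conj.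
assert (He2 : e * e = D).
{ unfold e; rewrite Cexp_Ci.
  apply injective_projections; simpl; [rewrite <- cos_plus|];
    change (fst D) with (Re D); change (snd D) with (Im D).
  - rewrite <- Hc; f_equal; lra.
  - rewrite <- Hs. replace th with (2 * (th / 2))%R at 5 by field.
    rewrite sin_2a; ring. }
clearbody e.
exists (Cconj e * a), (Cconj e * c).
split; [lra|split; [|repeat split]].
- apply Cmod2_conj1.
  rewrite !Cmult_conj, !Cconj_conj.
  transitivity (e * Cconj e * (Cconj a * a + Cconj c * c)); [ring|].
  rewrite He, H00; ring.
- transitivity (e * Cconj e * a); [rewrite He|]; ring.
- rewrite Cmult_conj, Cconj_conj, Hb, <- He2; ring.
- transitivity (e * Cconj e * c); [rewrite He|]; ring.
- rewrite Cmult_conj, Cconj_conj, Hd, <- He2; ring.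
Qed.

Lemma unitary2_param_inj (J : @matrix C 2 2) (phi phi' : R) (alpha alpha' beta beta' : C) :
  unitary2_param J phi alpha beta -> unitary2_param J phi' alpha' beta' ->
  phi = phi' /\ alpha = alpha' /\ beta = beta'.
Proof.
intros (Hp & Hm & H00 & H01 & H10 & H11) (Hp' & Hm' & H00' & H01' & H10' & H11').
apply Cmod2_conj1 in Hm; apply Cmod2_conj1 in Hm'.
rewrite H00 in H00'; rewrite H01 in H01'; rewrite H10 in H10'; rewrite H11 in H11'.
assert (E := Cexp_Ci_conj phi).
assert (Hphi : phi = phi').
{ assert (HD : Cexp (Ci * RtoC phi) * Cexp (Ci * RtoC phi) =
               Cexp (Ci * RtoC phi') * Cexp (Ci * RtoC phi')).
  { set (e := Cexp (Ci * RtoC phi)) in *; set (e' := Cexp (Ci * RtoC phi')) in *.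
    transitivity (e * e * (alpha * Cconj alpha + beta * Cconj beta));
      [rewrite Hm; ring|].
    transitivity (e' * e' * (alpha' * Cconj alpha' + beta' * Cconj beta'));
      [|rewrite Hm'; ring].
    transitivity (e * alpha * (e * Cconj alpha) - e * - Cconj beta * (e * beta));
      [ring|].
    rewrite H00', H01', H10', H11'; ring. }
  rewrite !Cexp_Ci in HD.
  assert (Hre := f_equal fst HD); assert (Him := f_equal snd HD); simpl in Hre, Him.
  assert (S : (sin (phi - phi') = 0)%R).
  { assert (Hs := sin2_cos2 phi); assert (Hs' := sin2_cos2 phi').
    unfold Rsqr in Hs, Hs'. rewrite sin_minus. nra. }
  destruct (Rtotal_order phi phi') as [h|[h|h]]; [|exact h|].
  - assert (0 < sin (phi' - phi))%R by (apply sin_gt_0; lra).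
    replace (phi' - phi)%R with (- (phi - phi'))%R in H by ring.
    rewrite sin_neg in H; lra.
  - assert (0 < sin (phi - phi'))%R by (apply sin_gt_0; lra). lra. }
subst phi'; split; [reflexivity|].
set (e := Cexp (Ci * RtoC phi)) in *.
split.
- transitivity (Cconj e * (e * alpha)); [|rewrite H00'];
    [transitivity (e * Cconj e * alpha)|transitivity (e * Cconj e * alpha')];
    try ring; rewrite E; ring.
- transitivity (Cconj e * (e * beta)); [|rewrite H10'];
    [transitivity (e * Cconj e * beta)|transitivity (e * Cconj e * beta')];
    try ring; rewrite E; ring.
Qed.

(* Main.v *)
Require Import Defs.
From Stdlib Require Import Reals Lra.
From Coquelicot Require Import Coquelicot.

(** For a fixed sign of y the integrand has an elementary antiderivative in
    terms of [Lambda] itself.  Write s = sqrt(it) and, for a complex constant c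
    and a purely imaginary kap,
      P_c(r) = Lambda((a + r)/(2s) + c s) e^{-(a + r)^2/(4it)} e^{kap r}.
    Since Lambda'(u) = 2 u Lambda(u) - 2/sqrt(pi), and s^2 = it,
      P_c' = (c + kap) P_c - e^{-(a + r)^2/(4it)} e^{kap r} / (s sqrt(pi))
    ([is_derive_packet]).  The choice c = -kap integrates the Gaussian terms of
    the Green's function, and (P_w - P_{-kap})/(w + kap) integrates its
    [Lambda] terms.  If w + kap = 0 then w = 0, because w is real, and the
    coefficient mu, a multiple of w, vanishes too.

    All these antiderivatives tend to 0 at infinity ([packet_vanishes]): the
    two exponentials have modulus one, the argument of [Lambda] moves to the
    right with constant speed, and |Lambda(u)| <= 1/(sqrt(pi) Re u) for
    Re u > 0 ([Lambda_bound]).  Hence each half line contributes minus the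
    value of an antiderivative at r = 0 ([half_line_integral]), with
    kap = ik on the right half line and kap = -ik on the left one.

    The free kernel e^{-(x - y)^2/(4it)} is covered by the same computation
    with a = -x on the right and a = x on the left.  Its two contributions are
    half of Lambda(-v) and half of Lambda(v), up to the common factor
    e^{-x^2/(4it)}, where v = x/(2s) + iks.  The reflection formula
    Lambda(v) + Lambda(-v) = 2 e^{v^2} turns them into the plane wave
    e^{ikx - ik^2 t}.

    The bound on [Lambda] comes from integrating e^{-xi^2} along the horizontal
    ray from u to infinity.  This rests on the derivative of the error function
    along straight lines ([is_derive_Cerf_line]) and on the Gaussian integral
    ([erf_tail]). *)
Open Scope C_scope.

Local Notation is_derive_C f x l :=
  (is_derive (K := R_AbsRing) (V := C_R_NormedModule) f x (l : C)%C).
Local Notation is_RInt_C f a b l :=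
  (is_RInt (V := C_R_NormedModule) f a b (l : C)%C).
Local Notation RInt_C f a b :=
  (RInt (V := C_R_CompleteNormedModule) f a b).

(** * Calculus of complex-valued functions of real variables *)

Lemma exp_mono (x y : R) : (x <= y)%R -> (exp x <= exp y)%R.
Proof. intros [H|H]; [now apply Rlt_le, exp_increasing|rewrite H; lra]. Qed.

Lemma is_derive_pair (f : R -> C) (x : R) (l : C) :
  is_derive (fun r => fst (f r)) x (fst l) ->
  is_derive (fun r => snd (f r)) x (snd l) ->
  is_derive_C f x l.
Proof.
intros H1 H2.
apply (filterdiff_ext (V := C_R_NormedModule)
  (fun r => (fst (f r), snd (f r)))).
{ now intros r; destruct (f r). }
apply (filterdiff_comp'_2 (W := C_R_NormedModule)
  (fun r => fst (f r)) (fun r => snd (f r)) (fun a b => (a, b)) x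
  (fun y => scal y (fst l)) (fun y => scal y (snd l)) (fun a b => (a, b))
  H1 H2).
eapply filterdiff_ext_lin.
- eapply filterdiff_ext; [|apply (filterdiff_id (V:=C_R_NormedModule))].
  now intros [u v].
- now intros [u v].
Qed.

Lemma is_derive_fst (f : R -> C) (x : R) (l : C) :
  is_derive_C f x l -> is_derive (fun r => fst (f r)) x (fst l).
Proof.
intros H.
apply (filterdiff_comp' (V := C_R_NormedModule) f (fun z : C => fst z) x
  (fun y => scal y l) (fun z : C => fst z) H).
apply filterdiff_linear, (is_linear_fst (U := R_NormedModule) (V := R_NormedModule)).
Qed.

Lemma is_derive_snd (f : R -> C) (x : R) (l : C) :
  is_derive_C f x l -> is_derive (fun r => snd (f r)) x (snd l).
Proof.
intros H.
apply (filterdiff_comp' (V := C_R_NormedModule) f (fun z : C => snd z) x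
  (fun y => scal y l) (fun z : C => snd z) H).
apply filterdiff_linear, (is_linear_snd (U := R_NormedModule) (V := R_NormedModule)).
Qed.

Lemma is_derive_Cmult (f g : R -> C) (x : R) (df dg : C) :
  is_derive_C f x df ->
  is_derive_C g x dg ->
  is_derive_C (fun r => f r * g r) x (df * g x + f x * dg).
Proof.
intros Hf Hg.
assert (f1 := is_derive_fst _ _ _ Hf); assert (f2 := is_derive_snd _ _ _ Hf).
assert (g1 := is_derive_fst _ _ _ Hg); assert (g2 := is_derive_snd _ _ _ Hg).
apply is_derive_Reals in f1, f2, g1, g2.
apply is_derive_pair; simpl; apply is_derive_Reals.
- replace (_ - _ + (_ - _))%R with
    ((fst df * fst (g x) + fst (f x) * fst dg) -
     (snd df * snd (g x) + snd (f x) * snd dg))%R by ring.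
  apply (derivable_pt_lim_minus (fun r => fst (f r) * fst (g r))%R
    (fun r => snd (f r) * snd (g r))%R);
  now apply (derivable_pt_lim_mult (fun r => _ (f r)) (fun r => _ (g r))).
- replace (_ + _ + (_ + _))%R with
    ((fst df * snd (g x) + fst (f x) * snd dg) +
     (snd df * fst (g x) + snd (f x) * fst dg))%R by ring.
  apply (derivable_pt_lim_plus (fun r => fst (f r) * snd (g r))%R
    (fun r => snd (f r) * fst (g r))%R);
  now apply (derivable_pt_lim_mult (fun r => _ (f r)) (fun r => _ (g r))).
Qed.

Lemma is_derive_Cexp (f : R -> C) (x : R) (df : C) :
  is_derive_C f x df ->
  is_derive_C (fun r => Cexp (f r)) x (df * Cexp (f x)).
Proof.
intros Hf.
assert (f1 := is_derive_fst _ _ _ Hf); assert (f2 := is_derive_snd _ _ _ Hf).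
apply is_derive_Reals in f1, f2.
apply is_derive_pair; simpl; unfold Re, Im; apply is_derive_Reals.
- replace (_ - _)%R with
    (exp (fst (f x)) * fst df * cos (snd (f x)) +
     exp (fst (f x)) * (- sin (snd (f x)) * snd df))%R by ring.
  apply (derivable_pt_lim_mult (fun r => exp (fst (f r))) (fun r => cos (snd (f r)))).
  + apply (derivable_pt_lim_comp (fun r => fst (f r)) exp); [exact f1|].
    apply derivable_pt_lim_exp.
  + apply (derivable_pt_lim_comp (fun r => snd (f r)) cos); [exact f2|].
    apply derivable_pt_lim_cos.
- replace (_ + _)%R with
    (exp (fst (f x)) * fst df * sin (snd (f x)) +
     exp (fst (f x)) * (cos (snd (f x)) * snd df))%R by ring.
  apply (derivable_pt_lim_mult (fun r => exp (fst (f r))) (fun r => sin (snd (f r)))).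
  + apply (derivable_pt_lim_comp (fun r => fst (f r)) exp); [exact f1|].
    apply derivable_pt_lim_exp.
  + apply (derivable_pt_lim_comp (fun r => snd (f r)) sin); [exact f2|].
    apply derivable_pt_lim_sin.
Qed.

Lemma is_derive_Cconst (c : C) (x : R) :
  is_derive_C (fun _ => c) x 0.
Proof. apply (is_derive_const (V := C_R_NormedModule)). Qed.

Lemma is_derive_Cplus (f g : R -> C) (x : R) (df dg : C) :
  is_derive_C f x df ->
  is_derive_C g x dg ->
  is_derive_C (fun r => f r + g r) x (df + dg).
Proof. apply (is_derive_plus (V := C_R_NormedModule)). Qed.

Lemma is_derive_Copp (f : R -> C) (x : R) (df : C) :
  is_derive_C f x df ->
  is_derive_C (fun r => - f r) x (- df).
Proof. apply (is_derive_opp (V := C_R_NormedModule)). Qed.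

Lemma is_derive_Cminus (f g : R -> C) (x : R) (df dg : C) :
  is_derive_C f x df ->
  is_derive_C g x dg ->
  is_derive_C (fun r => f r - g r) x (df - dg).
Proof. apply (is_derive_minus (V := C_R_NormedModule)). Qed.

Lemma is_derive_RtoC (x : R) :
  is_derive_C (fun r => RtoC r) x 1.
Proof.
apply is_derive_pair; simpl; [apply (is_derive_id (K := R_AbsRing))|].
apply (is_derive_const (K := R_AbsRing) (V := R_NormedModule)).
Qed.

Lemma is_derive_Csqr (f : R -> C) (x : R) (df : C) :
  is_derive_C f x df ->
  is_derive_C (fun r => f r ^ 2) x (2 * f x * df).
Proof.
intros H.
replace (2 * f x * df) with (df * f x + f x * df) by ring.
apply (is_derive_ext (V := C_R_NormedModule) (fun r => f r * f r)).
{ intros r; simpl; ring. }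
now apply is_derive_Cmult.
Qed.

Lemma continuous_Cpair {U : UniformSpace} (f : U -> C) (x : U) :
  continuous (fun u => fst (f u) : R) x -> continuous (fun u => snd (f u) : R) x ->
  continuous f x.
Proof.
intros H1 H2.
apply continuous_ext with (fun u => (fst (f u), snd (f u)) : C).
{ now intros u; destruct (f u). }
apply (continuous_comp_2 (W := R_UniformSpace) (V := R_UniformSpace)
 (fun u => fst (f u) : R) (fun u => snd (f u) : R)
 (fun a b => (a, b) : prod_UniformSpace R_UniformSpace R_UniformSpace) x H1 H2).
eapply continuous_ext; [|apply continuous_id]. now intros [u v].
Qed.

Lemma continuous_Cfst {U : UniformSpace} (f : U -> C) (x : U) :
  continuous f x -> continuous (fun u => fst (f u) : R) x.
Proof.
intros Hf; apply (continuous_comp f (fun z : C => fst z : R)); [exact Hf|].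
destruct (f x); apply (continuous_fst (U := R_UniformSpace) (V := R_UniformSpace)).
Qed.

Lemma continuous_Csnd {U : UniformSpace} (f : U -> C) (x : U) :
  continuous f x -> continuous (fun u => snd (f u) : R) x.
Proof.
intros Hf; apply (continuous_comp f (fun z : C => snd z : R)); [exact Hf|].
destruct (f x); apply (continuous_snd (U := R_UniformSpace) (V := R_UniformSpace)).
Qed.

Lemma continuous_Cplus {U : UniformSpace} (f g : U -> C) (x : U) :
  continuous f x -> continuous g x -> continuous (fun u => f u + g u) x.
Proof. apply (continuous_plus (V := C_R_NormedModule)). Qed.

Lemma continuous_Copp {U : UniformSpace} (f : U -> C) (x : U) :
  continuous f x -> continuous (fun u => - f u) x.
Proof. apply (continuous_opp (V := C_R_NormedModule)). Qed.

Lemma continuous_Cmult {U : UniformSpace} (f g : U -> C) (x : U) :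
  continuous f x -> continuous g x -> continuous (fun u => f u * g u) x.
Proof.
intros Hf Hg.
assert (f1 := continuous_Cfst _ _ Hf); assert (f2 := continuous_Csnd _ _ Hf).
assert (g1 := continuous_Cfst _ _ Hg); assert (g2 := continuous_Csnd _ _ Hg).
apply continuous_Cpair; simpl.
- apply (continuous_minus (V := R_NormedModule));
    now apply (continuous_mult (K := R_AbsRing)).
- apply (continuous_plus (V := R_NormedModule));
    now apply (continuous_mult (K := R_AbsRing)).
Qed.

Lemma continuous_Cminus {U : UniformSpace} (f g : U -> C) (x : U) :
  continuous f x -> continuous g x -> continuous (fun u => f u - g u) x.
Proof. apply (continuous_minus (V := C_R_NormedModule)). Qed.

Lemma continuous_Csqr {U : UniformSpace} (f : U -> C) (x : U) :
  continuous f x -> continuous (fun u => f u ^ 2) x.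
Proof.
intros H; apply continuous_ext with (fun u => f u * f u).
- intros u; simpl; ring.
- now apply continuous_Cmult.
Qed.

Lemma continuous_RtoC {U : UniformSpace} (f : U -> R) (x : U) :
  continuous f x -> continuous (fun u => RtoC (f u)) x.
Proof.
intros Hf; apply continuous_Cpair; simpl; [exact Hf|apply continuous_const].
Qed.

Lemma continuous_Cexp {U : UniformSpace} (f : U -> C) (x : U) :
  continuous f x -> continuous (fun u => Cexp (f u)) x.
Proof.
intros Hf.
assert (f1 := continuous_Cfst _ _ Hf); assert (f2 := continuous_Csnd _ _ Hf).
apply continuous_Cpair; simpl; unfold Re, Im;
  apply (continuous_mult (K := R_AbsRing)).
- apply (continuous_comp (fun u => fst (f u) : R) exp); [exact f1|]. apply continuous_exp.
- apply (continuous_comp (fun u => snd (f u) : R) cos); [exact f2|]. apply continuous_cos.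
- apply (continuous_comp (fun u => fst (f u) : R) exp); [exact f1|]. apply continuous_exp.
- apply (continuous_comp (fun u => snd (f u) : R) sin); [exact f2|]. apply continuous_sin.
Qed.

Ltac Cderive :=
  lazymatch goal with
  | |- is_derive (fun _ => ?c) _ _ => apply (is_derive_Cconst c)
  | |- is_derive (fun r => RtoC r) _ _ => apply is_derive_RtoC
  | |- is_derive (fun r => Cpow (@?f r) 2) _ _ => apply (is_derive_Csqr f); Cderive
  | |- is_derive (fun r => Cexp (@?f r)) _ _ => apply (is_derive_Cexp f); Cderive
  | |- is_derive (fun r => Cmult (@?f r) (@?g r)) _ _ =>
      apply (is_derive_Cmult f g); Cderive
  | |- is_derive (fun r => Cplus (@?f r) (@?g r)) _ _ =>
      apply (is_derive_Cplus f g); Cderive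
  | |- is_derive (fun r => Cminus (@?f r) (@?g r)) _ _ =>
      apply (is_derive_Cminus f g); Cderive
  | |- is_derive (fun r => Copp (@?f r)) _ _ => apply (is_derive_Copp f); Cderive
  | _ => idtac
  end.

Ltac Ccontinuous :=
  lazymatch goal with
  | |- continuous (fun _ => ?c) _ => apply (continuous_const c)
  | |- continuous (fun u => RtoC (@?f u)) _ => apply (continuous_RtoC f); Ccontinuous
  | |- continuous (fun u => Cexp (@?f u)) _ => apply (continuous_Cexp f); Ccontinuous
  | |- continuous (fun u => Cmult (@?f u) (@?g u)) _ =>
      apply (continuous_Cmult f g); Ccontinuous
  | |- continuous (fun u => Cplus (@?f u) (@?g u)) _ =>
      apply (continuous_Cplus f g); Ccontinuous
  | |- continuous (fun u => Cminus (@?f u) (@?g u)) _ =>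
      apply (continuous_Cminus f g); Ccontinuous
  | |- continuous (fun u => Copp (@?f u)) _ => apply (continuous_Copp f); Ccontinuous
  | |- continuous (fun u => Cpow (@?f u) 2) _ => apply (continuous_Csqr f); Ccontinuous
  | |- continuous (fun u => fst u) _ => apply continuous_fst
  | |- continuous (fun u => snd u) _ => apply continuous_snd
  | |- continuous (fun u => u) _ => apply continuous_id
  | _ => idtac
  end.

(** * Integrals of complex-valued functions *)

Lemma is_RInt_fst (f : R -> C) (a b : R) (l : C) :
  is_RInt_C f a b l -> is_RInt (fun s => fst (f s)) a b (fst l).
Proof. apply (is_RInt_fct_extend_fst (U := R_NormedModule) (V := R_NormedModule)). Qed.

Lemma is_RInt_snd (f : R -> C) (a b : R) (l : C) :
  is_RInt_C f a b l -> is_RInt (fun s => snd (f s)) a b (snd l).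
Proof. apply (is_RInt_fct_extend_snd (U := R_NormedModule) (V := R_NormedModule)). Qed.

Lemma is_RInt_continuous_C (f : R -> C) (a b : R) :
  (forall s, continuous f s) ->
  is_RInt_C f a b (RInt_C f a b).
Proof.
intros H; apply (RInt_correct (V := C_R_CompleteNormedModule)).
now apply (ex_RInt_continuous (V := C_R_CompleteNormedModule)).
Qed.

Lemma continuous_section (f : R -> R -> C) (r s : R) :
  continuous (fun p : R * R => f (fst p) (snd p)) (r, s) -> continuous (f r) s.
Proof.
intros H.
apply (continuous_comp_2 (fun _ : R => r) (fun s => s) f s);
  [apply continuous_const|apply continuous_id|exact H].
Qed.

(** Differentiation under the integral sign; both components are instances of
    the real theorem, whose continuity hypothesis concerns the derivative as a
    function of two variables. *)
Lemma is_derive_RInt_param_C (f df : R -> R -> C) (a b x : R) :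
  (forall r s, is_derive_C (fun r => f r s) r (df r s)) ->
  (forall r s, continuous (fun p : R * R => f (fst p) (snd p)) (r, s)) ->
  (forall r s, continuous (fun p : R * R => df (fst p) (snd p)) (r, s)) ->
  is_derive_C
    (fun r => RInt_C (f r) a b) x
    (RInt_C (df x) a b).
Proof.
intros Hd Hf Hdf.
assert (If : forall r, is_RInt_C (f r) a b
                (RInt_C (f r) a b)).
{ intros r; apply is_RInt_continuous_C; intros s; apply continuous_section, Hf. }
assert (Idf := is_RInt_continuous_C (df x) a b
  (fun s => continuous_section _ _ _ (Hdf x s))).
apply is_derive_pair.
- apply (is_derive_ext (fun r => RInt (fun s => fst (f r s)) a b)).
  { intros r; apply is_RInt_unique, is_RInt_fst, If. }
  assert (D : forall r s, is_derive (fun r => fst (f r s)) r (fst (df r s))).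
  { intros r s; apply is_derive_fst, (Hd r s). }
  rewrite <- (is_RInt_unique _ _ _ _ (is_RInt_fst _ _ _ _ Idf)).
  rewrite <- (RInt_ext (fun s => Derive (fun r => fst (f r s)) x)).
  2:{ intros s _; apply is_derive_unique, D. }
  apply is_derive_RInt_param.
  + apply filter_forall; intros r s _; eexists; apply D.
  + intros s _; apply continuity_2d_pt_ext with (fun u v => fst (df u v)).
    { intros u v; symmetry; apply is_derive_unique, D. }
    apply continuity_2d_pt_filterlim, (continuous_Cfst _ _ (Hdf x s)).
  + apply filter_forall; intros r; eexists; apply is_RInt_fst, If.
- apply (is_derive_ext (fun r => RInt (fun s => snd (f r s)) a b)).
  { intros r; apply is_RInt_unique, is_RInt_snd, If. }
  assert (D : forall r s, is_derive (fun r => snd (f r s)) r (snd (df r s))).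
  { intros r s; apply is_derive_snd, (Hd r s). }
  rewrite <- (is_RInt_unique _ _ _ _ (is_RInt_snd _ _ _ _ Idf)).
  rewrite <- (RInt_ext (fun s => Derive (fun r => snd (f r s)) x)).
  2:{ intros s _; apply is_derive_unique, D. }
  apply is_derive_RInt_param.
  + apply filter_forall; intros r s _; eexists; apply D.
  + intros s _; apply continuity_2d_pt_ext with (fun u v => snd (df u v)).
    { intros u v; symmetry; apply is_derive_unique, D. }
    apply continuity_2d_pt_filterlim, (continuous_Csnd _ _ (Hdf x s)).
  + apply filter_forall; intros r; eexists; apply is_RInt_snd, If.
Qed.

Lemma is_RInt_C_derive (f df : R -> C) (a b : R) :
  (forall r, is_derive_C f r (df r)) ->
  (forall r, continuous df r) ->
  is_RInt_C df a b (f b - f a).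
Proof.
intros H Hc.
apply (is_RInt_derive (V := C_R_CompleteNormedModule) f df); intros; auto.
Qed.

Lemma is_RInt_Cmult (c : C) (f : R -> C) (a b : R) (l : C) :
  is_RInt_C f a b l -> is_RInt_C (fun s => c * f s) a b (c * l).
Proof.
intros H; assert (H1 := is_RInt_fst _ _ _ _ H); assert (H2 := is_RInt_snd _ _ _ _ H).
apply (is_RInt_fct_extend_pair (U := R_NormedModule) (V := R_NormedModule)
  (fun s => c * f s)); simpl.
- apply (is_RInt_minus (V := R_NormedModule));
    now apply (is_RInt_scal (V := R_NormedModule)).
- apply (is_RInt_plus (V := R_NormedModule));
    now apply (is_RInt_scal (V := R_NormedModule)).
Qed.

(** * The error function along straight lines *)

(** The segment integral defining [Cerf] behaves like a contour integral
    because the derivative of r |-> z e^{-(s z)^2}, at z = p + r q, is the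
    derivative of s |-> s q e^{-(s z)^2}; integrating over s leaves the boundary
    term at s = 1. *)
Lemma is_derive_Cerf_line (p q : C) (x : R) :
  is_derive_C (fun r => Cerf (p + RtoC r * q)) x
    (RtoC (2 / sqrt PI) * q * Cexp (- (p + RtoC x * q) ^ 2)).
Proof.
set (f := fun r s : R => (p + RtoC r * q) * Cexp (- (RtoC s * (p + RtoC r * q)) ^ 2)).
set (df := fun r s : R => q * Cexp (- (RtoC s * (p + RtoC r * q)) ^ 2) *
   (1 - 2 * (RtoC s * (p + RtoC r * q)) ^ 2)).
assert (D : is_derive_C
    (fun r => RInt_C (f r) 0 1) x
    (RInt_C (df x) 0 1)).
{ apply is_derive_RInt_param_C.
  - intros r s; unfold f, df. evar_last; [Cderive|simpl; ring].
  - intros r s; unfold f; Ccontinuous.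
  - intros r s; unfold df; Ccontinuous. }
assert (E : RInt_C (df x) 0 1 =
  q * Cexp (- (p + RtoC x * q) ^ 2)).
{ apply is_RInt_unique.
  evar_last.
  apply (is_RInt_C_derive (fun s => RtoC s * q * Cexp (- (RtoC s * (p + RtoC x * q)) ^ 2))).
  - intros r; unfold df. evar_last; [Cderive|simpl; ring].
  - intros r; unfold df; Ccontinuous.
  - simpl. replace (1 * (p + x * q)) with (p + x * q) by ring. ring. }
rewrite E in D; clear E.
rewrite <- Cmult_assoc.
apply (is_derive_ext (V := C_R_NormedModule)
  (fun r => RtoC (2 / sqrt PI) * RInt_C (f r) 0 1)).
- intros r; unfold Cerf; f_equal.
  apply is_RInt_unique, is_RInt_Cmult, is_RInt_continuous_C.
  intros s; Ccontinuous.
- evar_last; [apply is_derive_Cmult; [apply is_derive_Cconst|exact D]|simpl; ring].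
Qed.

(** * The Gaussian integral *)

Definition erf (x : R) : R := (2 / sqrt PI * (x * RInt (fun s => exp (- (s * x) ^ 2)) 0 1))%R.

Lemma ex_RInt_exp (x : R) : ex_RInt (fun s => exp (- (s * x) ^ 2)) 0 1.
Proof.
apply (ex_RInt_continuous (V := R_CompleteNormedModule)); intros s _.
apply (ex_derive_continuous (V := R_NormedModule)); auto_derive; easy.
Qed.

Lemma Cexp_RtoC (x : R) : Cexp (RtoC x) = RtoC (exp x).
Proof. unfold Cexp; simpl; rewrite cos_0, sin_0; apply injective_projections; simpl; ring. Qed.

Lemma Cerf_RtoC (x : R) : Cerf (RtoC x) = RtoC (erf x).
Proof.
unfold Cerf, erf.
rewrite !RtoC_mult; do 2 f_equal.
apply is_RInt_unique.
apply (is_RInt_ext (V := C_R_NormedModule) (fun s => RtoC (exp (- (s * x) ^ 2)))).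
{ intros s _; rewrite <- Cexp_RtoC; f_equal.
  now rewrite RtoC_opp, RtoC_pow, RtoC_mult. }
apply (is_RInt_fct_extend_pair (U := R_NormedModule) (V := R_NormedModule)); simpl.
- apply (RInt_correct (V := R_CompleteNormedModule)), ex_RInt_exp.
- evar_last; [apply (is_RInt_const (V := R_NormedModule))|].
  unfold scal; simpl; unfold mult; simpl; ring.
Qed.

Lemma is_derive_erf (x : R) : is_derive erf x (2 / sqrt PI * exp (- x ^ 2))%R.
Proof.
apply (is_derive_ext (fun r => fst (Cerf (0 + RtoC r * 1)))).
{ intros r; rewrite Cmult_1_r, Cplus_0_l, Cerf_RtoC; reflexivity. }
evar_last; [apply is_derive_fst, is_derive_Cerf_line|].
rewrite !Cmult_1_r, Cplus_0_l, <- RtoC_pow, <- RtoC_opp, Cexp_RtoC.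
simpl; ring.
Qed.

(** The companion in the classical evaluation of the Gaussian integral: up to a
    constant factor its derivative is the opposite of that of erf^2, and it
    decays like the Gaussian. *)
Definition gauss_aux (x : R) : R :=
  RInt (fun s => exp (- x ^ 2 * (1 + s ^ 2)) / (1 + s ^ 2))%R 0 1.

Lemma ex_RInt_gauss_aux (x : R) :
  ex_RInt (fun s => exp (- x ^ 2 * (1 + s ^ 2)) / (1 + s ^ 2))%R 0 1.
Proof.
apply (ex_RInt_continuous (V := R_CompleteNormedModule)); intros s _.
apply (ex_derive_continuous (V := R_NormedModule)); auto_derive; nra.
Qed.

Lemma is_derive_gauss_aux (x : R) :
  is_derive gauss_aux x (- (sqrt PI * erf x * exp (- x ^ 2)))%R.
Proof.
assert (HP : (0 < sqrt PI)%R) by apply sqrt_lt_R0, PI_RGT_0.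
assert (D : forall r s, is_derive (fun u => exp (- u ^ 2 * (1 + s ^ 2)) / (1 + s ^ 2))%R r
   (- 2 * exp (- r ^ 2) * (r * exp (- (s * r) ^ 2)))%R).
{ intros r s; auto_derive; [nra|].
  replace (- (s * r) ^ 2)%R with (- r ^ 2 * s ^ 2)%R by ring.
  replace (- (r * (r * 1)) * (1 + s * (s * 1)))%R with (- r ^ 2 + - r ^ 2 * s ^ 2)%R by ring.
  rewrite exp_plus; field; nra. }
evar_last.
- apply is_derive_RInt_param.
  + apply filter_forall; intros r s _; eexists; apply D.
  + intros s _.
    apply continuity_2d_pt_ext with
      (fun u v => - 2 * exp (- u ^ 2) * (u * exp (- (v * u) ^ 2)))%R.
    { intros u v; symmetry; apply is_derive_unique, D. }
    simpl.
    assert (H1 := continuity_2d_pt_id1 x s); assert (H2 := continuity_2d_pt_id2 x s).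
    assert (Hc := fun c => continuity_2d_pt_const x s c).
    assert (He : forall y, continuity_pt exp y).
    { intros y; apply derivable_continuous_pt, derivable_pt_exp. }
    repeat first [ assumption | apply Hc | apply continuity_2d_pt_mult
      | apply continuity_1d_2d_pt_comp with (f := exp); [apply He|]
      | apply continuity_2d_pt_opp ].
  + apply filter_forall; intros r; apply ex_RInt_gauss_aux.
- apply is_RInt_unique.
  apply (is_RInt_ext (V := R_NormedModule)
    (fun s => scal (- 2 * exp (- x ^ 2) * x)%R (exp (- (s * x) ^ 2)))).
  { intros s _; symmetry; etransitivity; [exact (is_derive_unique _ _ _ (D x s))|].
    unfold scal; simpl; unfold mult; simpl; ring. }
  evar_last.
  + apply (is_RInt_scal (V := R_NormedModule)).
    apply (RInt_correct (V := R_CompleteNormedModule)), ex_RInt_exp.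
  + unfold erf, scal; simpl; unfold mult; simpl; field; lra.
Qed.

Lemma gauss_aux_0 : gauss_aux 0 = (PI / 4)%R.
Proof.
unfold gauss_aux; rewrite <- atan_1.
replace (atan 1) with (minus (atan 1) (atan 0)).
2:{ rewrite atan_0; unfold minus, plus, opp; simpl; ring. }
apply is_RInt_unique, (is_RInt_derive (V := R_CompleteNormedModule) atan).
- intros s _; apply is_derive_Reals.
  replace (_ / _)%R with (/ (1 + s ^ 2))%R.
  2:{ replace (- 0 ^ 2 * (1 + s ^ 2))%R with 0%R by ring. rewrite exp_0; field; nra. }
  apply derivable_pt_lim_atan.
- intros s _; apply (ex_derive_continuous (V := R_NormedModule)); auto_derive; nra.
Qed.

Lemma gauss_aux_bound (x : R) : (0 <= gauss_aux x <= PI / 4 * exp (- x ^ 2))%R.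
Proof.
rewrite <- gauss_aux_0; split.
- apply RInt_ge_0; [lra|apply ex_RInt_gauss_aux|].
  intros s _; apply Rlt_le, Rdiv_lt_0_compat; [apply exp_pos|nra].
- rewrite Rmult_comm; unfold gauss_aux.
  rewrite <- (RInt_scal (V := R_CompleteNormedModule)) by apply ex_RInt_gauss_aux.
  apply RInt_le; [lra|apply ex_RInt_gauss_aux| |].
  { apply (ex_RInt_scal (V := R_CompleteNormedModule)), ex_RInt_gauss_aux. }
  intros s _; unfold scal; simpl; unfold mult; simpl.
  replace (- (0 * (0 * 1)) * (1 + s * (s * 1)))%R with 0%R by ring.
  rewrite exp_0; unfold Rdiv; rewrite Rmult_1_l.
  apply Rmult_le_compat_r.
  + apply Rlt_le, Rinv_0_lt_compat; nra.
  + apply exp_mono.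
    assert (H1 := pow2_ge_0 x); assert (H2 := pow2_ge_0 s). simpl in H1, H2. nra.
Qed.

(** The derivative vanishes, and at 0 the sum is 4/pi times atan 1. *)
Lemma erf_gauss_aux (x : R) : (erf x ^ 2 + 4 / PI * gauss_aux x = 1)%R.
Proof.
assert (HP := PI_RGT_0).
assert (HS : (0 < sqrt PI)%R) by now apply sqrt_lt_R0.
assert (HSS : (sqrt PI * sqrt PI = PI)%R) by (apply sqrt_sqrt; lra).
set (F := fun r => (erf r ^ 2 + 4 / PI * gauss_aux r)%R).
assert (D : forall r, is_derive F r 0%R).
{ intros r; unfold F.
  assert (D1 := is_derive_erf r); assert (D2 := is_derive_gauss_aux r).
  auto_derive.
  - repeat split; eexists; eassumption.
  - assert (E1 := is_derive_unique _ _ _ D1); assert (E2 := is_derive_unique _ _ _ D2).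
    change (Derive (fun u : R => erf u) r = 2 / sqrt PI * exp (- r ^ 2))%R in E1.
    change (Derive (fun u : R => gauss_aux u) r = - (sqrt PI * erf r * exp (- r ^ 2)))%R in E2.
    rewrite E1, E2.
    replace PI with (sqrt PI * sqrt PI)%R at 2 by exact HSS. simpl; field; lra. }
assert (F0 : F 0%R = 1%R).
{ unfold F; rewrite gauss_aux_0; unfold erf; simpl; field; lra. }
change (F x = 1%R); rewrite <- F0.
destruct (Rtotal_order x 0) as [h|[->|h]]; [| easy |symmetry];
  (apply (eq_is_derive (V := R_NormedModule)); [intros; apply D|exact h]).
Qed.

(** (1 - erf)(1 + erf) is a multiple of [gauss_aux], and 1 + erf >= 1 on the
    positive half line. *)
Lemma erf_tail (x : R) : (0 <= x)%R -> (Rabs (1 - erf x) <= exp (- x ^ 2))%R.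
Proof.
intros Hx.
assert (HP := PI_RGT_0).
assert (HS : (0 < sqrt PI)%R) by now apply sqrt_lt_R0.
assert (H0 : (0 <= erf x)%R).
{ unfold erf; apply Rmult_le_pos; [apply Rlt_le, Rdiv_lt_0_compat; lra|].
  apply Rmult_le_pos; [exact Hx|].
  apply RInt_ge_0; [lra|apply ex_RInt_exp|intros s _; apply Rlt_le, exp_pos]. }
assert (E := erf_gauss_aux x); destruct (gauss_aux_bound x) as [B0 B1].
assert (G : (4 / PI * gauss_aux x <= exp (- x ^ 2))%R).
{ replace (exp (- x ^ 2)) with (4 / PI * (PI / 4 * exp (- x ^ 2)))%R by (field; lra).
  apply Rmult_le_compat_l; [apply Rlt_le, Rdiv_lt_0_compat; lra|exact B1]. }
assert (G0 : (0 <= 4 / PI * gauss_aux x)%R).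
{ apply Rmult_le_pos; [apply Rlt_le, Rdiv_lt_0_compat; lra|exact B0]. }
apply Rabs_le; split; nra.
Qed.

(** * Decay of Lambda in the right half plane *)

Lemma Cmod_RInt_le (f : R -> C) (g : R -> R) (a b : R) (l : C) (m : R) : (a <= b)%R ->
  (forall r, (a <= r <= b)%R -> (Cmod (f r) <= g r)%R) ->
  is_RInt_C f a b l -> is_RInt g a b m -> (Cmod l <= m)%R.
Proof.
intros Hab H Hf Hg; rewrite Cmod_norm.
apply (norm_RInt_le (V := C_R_NormedModule) f g a b); try assumption.
now intros r Hr; rewrite <- Cmod_norm; apply H.
Qed.

Lemma Cmod_Cexp (z : C) : Cmod (Cexp z) = exp (Re z).
Proof.
unfold Cmod, Cexp; simpl.
replace (_ + _)%R with (Rsqr (exp (Re z)) * (Rsqr (sin (Im z)) + Rsqr (cos (Im z))))%R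
  by (unfold Rsqr; ring).
rewrite sin2_cos2, Rmult_1_r; apply sqrt_Rsqr, Rlt_le, exp_pos.
Qed.

Lemma Cexp_plus (z w : C) : Cexp (z + w) = Cexp z * Cexp w.
Proof.
destruct z as [a b], w as [c d]; unfold Cexp; simpl.
rewrite exp_plus, cos_plus, sin_plus; apply injective_projections; simpl; ring.
Qed.

Lemma Cexp_0 : Cexp 0 = 1.
Proof. rewrite Cexp_RtoC, exp_0; reflexivity. Qed.

Lemma Cerf_opp (z : C) : Cerf (- z) = - Cerf z.
Proof.
unfold Cerf.
rewrite (RInt_ext (V := C_R_CompleteNormedModule) _ (fun s => Cexp (- (RtoC s * z) ^ 2))).
- ring.
- intros s _; f_equal; simpl; ring.
Qed.

Lemma Cerf_segment (p q : C) (r : R) :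
  is_RInt_C (fun s => RtoC (2 / sqrt PI) * q * Cexp (- (p + RtoC s * q) ^ 2)) 0 r
    (Cerf (p + RtoC r * q) - Cerf p).
Proof.
replace (Cerf p) with (Cerf (p + RtoC 0 * q)) by (f_equal; ring).
apply (is_RInt_C_derive (fun s => Cerf (p + RtoC s * q))).
- intros s; apply is_derive_Cerf_line.
- intros s; Ccontinuous.
Qed.

Lemma sqrt_PI_pos : (0 < sqrt PI)%R.
Proof. apply sqrt_lt_R0, PI_RGT_0. Qed.

(** The vertical segment from x to x + ib costs at most |b| times the largest
    value e^{b^2 - x^2} of the integrand there. *)
Lemma Cerf_tail (x b : R) : (0 <= x)%R ->
  (Cmod (1 - Cerf (x, b)) <=
   (1 + 2 / sqrt PI * Rabs b * exp (b ^ 2)) * exp (- x ^ 2))%R.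
Proof.
intros Hx; assert (HS := sqrt_PI_pos).
assert (S := Cerf_segment (RtoC x) (Ci * RtoC b) 1).
replace (RtoC x + 1 * (Ci * RtoC b)) with ((x, b) : C) in S
  by (apply injective_projections; simpl; ring).
set (M := (2 / sqrt PI * Rabs b * exp (b ^ 2) * exp (- x ^ 2))%R).
apply Cmod_RInt_le with (g := fun _ => M) (m := ((1 - 0) * M)%R) in S;
  [|lra| |apply (is_RInt_const (V := R_NormedModule))]; unfold M in *.
-   replace (1 - Cerf (x, b)) with
    ((1 - Cerf (RtoC x)) + - (Cerf (x, b) - Cerf (RtoC x))) by ring.
  eapply Rle_trans; [apply Cmod_triangle|].
  rewrite Cmod_opp, Cerf_RtoC, <- RtoC_minus, Cmod_R, <- Cerf_RtoC.
  assert (T := erf_tail x Hx); lra.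
- intros s Hs.
  rewrite !Cmod_mult, Cmod_Cexp, !Cmod_R, Cmod_Ci, Rmult_1_l, Rmult_assoc with (r3 := exp (- x ^ 2)).
  rewrite (Rabs_pos_eq (2 / sqrt PI)) by (apply Rlt_le, Rdiv_lt_0_compat; lra).
  apply Rmult_le_compat_l.
  { apply Rmult_le_pos; [apply Rlt_le, Rdiv_lt_0_compat; lra|apply Rabs_pos]. }
  rewrite <- exp_plus; simpl.
  apply exp_mono.
  { assert (Hs2 : (0 <= 1 - s * s)%R) by nra.
    assert (Hb2 := pow2_ge_0 b); simpl in Hb2.
    assert (Hp := Rmult_le_pos _ _ Hs2 Hb2). nra. }
Qed.

Lemma Cerf_tail_eventually (u : C) (eps : R) : (0 < eps)%R ->
  exists L : R, (0 <= L)%R /\ (Cmod (1 - Cerf (u + RtoC L)) <= eps)%R.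
Proof.
intros He; destruct u as [a b].
set (K := (1 + 2 / sqrt PI * Rabs b * exp (b ^ 2))%R).
assert (HK : (0 < K)%R).
{ unfold K; assert (HS := sqrt_PI_pos).
  assert (0 <= 2 / sqrt PI * Rabs b * exp (b ^ 2))%R; [|lra].
  apply Rmult_le_pos; [|apply Rlt_le, exp_pos].
  apply Rmult_le_pos; [apply Rlt_le, Rdiv_lt_0_compat; lra|apply Rabs_pos]. }
(* The point u + L has real part X; the three summands ensure X >= 1, L >= 0 and
   e^{X^2} >= K / eps. *)
set (X := (1 + Rabs a + K / eps)%R).
assert (Hq : (0 < K / eps)%R) by now apply Rdiv_lt_0_compat.
assert (Ha := Rle_abs a); assert (Ha' := Rabs_pos a).
exists (X - a)%R; split; [unfold X; lra|].
replace ((a, b) + RtoC (X - a)) with ((X, b) : C)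
  by (apply injective_projections; simpl; ring).
eapply Rle_trans; [apply Cerf_tail; unfold X; lra|]; fold K.
rewrite exp_Ropp.
assert (HX : (K / eps <= exp (X ^ 2))%R).
{ assert (H1 := exp_ineq1_le (X ^ 2)). assert (1 + K / eps <= X)%R by (unfold X; lra). nra. }
apply Rmult_le_reg_r with (exp (X ^ 2)); [apply exp_pos|].
rewrite Rmult_assoc, Rinv_l, Rmult_1_r by (apply Rgt_not_eq, exp_pos).
replace K with (eps * (K / eps))%R by (field; lra).
apply Rmult_le_compat_l; lra.
Qed.

(** Lambda(u) = 2/sqrt(pi) times the integral of e^{-2ur - r^2} over r > 0,
    whose integrand is bounded by e^{-2 r Re u}.  The proof truncates the ray at
    a finite L, where the remaining tail of the error function is negligible
    against the fixed factor e^{u^2}. *)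
Lemma Lambda_bound (u : C) : (0 < Re u)%R ->
  (Cmod (Lambda u) <= 1 / (sqrt PI * Re u))%R.
Proof.
intros Hu; assert (HS := sqrt_PI_pos).
assert (B : forall L, (0 <= L)%R ->
  (Cmod (Cexp (u ^ 2) * (Cerf (u + RtoC L) - Cerf u)) <= 1 / (sqrt PI * Re u))%R).
{ intros L HL.
  assert (S := Cerf_segment u 1 L).
  apply (is_RInt_Cmult (Cexp (u ^ 2))) in S.
  rewrite (Cmult_1_r (RtoC L)) in S.
  set (g := fun r => (- (1 / (sqrt PI * Re u)) * exp (- (2 * Re u * r)))%R).
  assert (G : is_RInt (fun r => 2 / sqrt PI * exp (- (2 * Re u * r)))%R 0 L (g L - g 0)%R).
  { apply (is_RInt_derive (V := R_CompleteNormedModule) g).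
    - intros r _; unfold g; auto_derive; [easy|field; lra].
    - intros r _; apply (ex_derive_continuous (V := R_NormedModule)); auto_derive; easy. }
  apply (fun H => Cmod_RInt_le _ _ _ _ _ _ HL H S) in G.
  - eapply Rle_trans; [exact G|].
    unfold g; rewrite Rmult_0_r, Ropp_0, exp_0.
    assert (H1 := exp_pos (- (2 * Re u * L))).
    assert (0 < 1 / (sqrt PI * Re u))%R; [|nra].
    apply Rdiv_lt_0_compat; [lra|now apply Rmult_lt_0_compat].
  - intros r Hr.
    rewrite !Cmult_1_r, (Cmult_comm (Cexp _)), <- Cmult_assoc, (Cmult_comm (Cexp _)),
      <- Cexp_plus, Cmod_mult, Cmod_Cexp, Cmod_R.
    rewrite (Rabs_pos_eq (2 / sqrt PI)) by (apply Rlt_le, Rdiv_lt_0_compat; lra).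
    apply Rmult_le_compat_l; [apply Rlt_le, Rdiv_lt_0_compat; lra|].
    apply exp_mono.
    { destruct u as [a b]; simpl; nra. }
 }
apply le_epsilon; intros eps He.
assert (HK := exp_pos (Re (u ^ 2))).
destruct (Cerf_tail_eventually u (eps / exp (Re (u ^ 2)))) as (L & HL & HT).
{ now apply Rdiv_lt_0_compat. }
unfold Lambda.
replace (Cexp (u ^ 2) * (1 - Cerf u)) with
  (Cexp (u ^ 2) * (Cerf (u + RtoC L) - Cerf u) + Cexp (u ^ 2) * (1 - Cerf (u + RtoC L)))
  by ring.
eapply Rle_trans; [apply Cmod_triangle|].
apply Rplus_le_compat; [now apply B|].
rewrite Cmod_mult, Cmod_Cexp.
apply Rmult_le_compat_l with (r := exp (Re (u ^ 2))) in HT; [|lra].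
eapply Rle_trans; [exact HT|]. apply Req_le; field; lra.
Qed.

Lemma Lambda_plus_opp (u : C) : Lambda u + Lambda (- u) = 2 * Cexp (u ^ 2).
Proof.
unfold Lambda; rewrite Cerf_opp.
replace ((- u) ^ 2) with (u ^ 2) by (simpl; ring). ring.
Qed.

Lemma is_derive_Lambda_line (p q : C) (x : R) :
  is_derive_C (fun r => Lambda (p + RtoC r * q)) x
    (2 * (p + RtoC x * q) * q * Lambda (p + RtoC x * q) - RtoC (2 / sqrt PI) * q).
Proof.
unfold Lambda.
evar_last.
- apply (is_derive_Cmult (fun r => Cexp ((p + RtoC r * q) ^ 2))
    (fun r => 1 - Cerf (p + RtoC r * q))); [Cderive|].
  apply is_derive_Cminus; [apply is_derive_Cconst|apply is_derive_Cerf_line].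
- assert (H : Cexp ((p + RtoC x * q) ^ 2) * Cexp (- (p + RtoC x * q) ^ 2) = 1).
  { rewrite <- Cexp_plus, Cplus_opp_r; apply Cexp_0. }
  simpl in H |- *.
  match type of H with ?a * ?b = _ => set (A := a) in *; set (B := b) in * end.
  transitivity (2 * (p + RtoC x * q) * q * (A * (1 - Cerf (p + RtoC x * q))) -
    RtoC (2 / sqrt PI) * q * (A * B)); [|rewrite H]; ring.
Qed.

(** * The antiderivatives *)

Lemma Csqrt_i_coords (t : R) :
  Csqrt_i t = (sqrt t / sqrt 2, sqrt t / sqrt 2)%R.
Proof.
unfold Csqrt_i; rewrite Cexp_Ci, cos_PI4, sin_PI4.
apply injective_projections; simpl; field; apply Rgt_not_eq, sqrt_lt_R0; lra.
Qed.

Lemma Csqrt_i_sqr (t : R) : (0 < t)%R -> Csqrt_i t ^ 2 = Ci * RtoC t.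
Proof.
intros Ht; rewrite Csqrt_i_coords.
assert (H2 : (sqrt 2 * sqrt 2 = 2)%R) by (apply sqrt_sqrt; lra).
assert (H3 : (0 < sqrt 2)%R) by (apply sqrt_lt_R0; lra).
assert (H4 : (sqrt t * sqrt t = t)%R) by (apply sqrt_sqrt; lra).
set (h := sqrt 2) in *; set (q := sqrt t) in *.
apply injective_projections; simpl; [ring|].
transitivity (2 * (q * q) / (h * h))%R; [field; lra|].
rewrite H2, H4; field.
Qed.

Lemma Csqrt_i_neq_0 (t : R) : (0 < t)%R -> Csqrt_i t <> 0.
Proof.
intros Ht H; assert (S := Csqrt_i_sqr t Ht); rewrite H in S.
apply (f_equal snd) in S; simpl in S; lra.
Qed.

Lemma Csqrt_i_PI (t : R) : (0 < t)%R -> Csqrt_i (PI * t) = RtoC (sqrt PI) * Csqrt_i t.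
Proof.
intros Ht; assert (HP := PI_RGT_0); unfold Csqrt_i.
rewrite sqrt_mult, RtoC_mult by lra; ring.
Qed.

Lemma Re_inv_Csqrt_i (t : R) : (0 < t)%R -> (0 < Re (/ (2 * Csqrt_i t)))%R.
Proof.
intros Ht; rewrite Csqrt_i_coords.
assert (H : (0 < sqrt t / sqrt 2)%R) by (apply Rdiv_lt_0_compat; apply sqrt_lt_R0; lra).
set (d := (sqrt t / sqrt 2)%R) in *; simpl.
apply Rdiv_lt_0_compat; nra.
Qed.

Definition chirp (t a : R) : C := Cexp (- (RtoC a ^ 2 / (4 * Ci * RtoC t))).

Lemma chirp_sqr (t a : R) : (0 < t)%R ->
  chirp t a = Cexp (- (RtoC a * / (2 * Csqrt_i t)) ^ 2).
Proof.
intros Ht; unfold chirp; f_equal.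
assert (H := Csqrt_i_neq_0 t Ht).
replace (4 * Ci * RtoC t) with (4 * (Csqrt_i t ^ 2)) by (rewrite Csqrt_i_sqr by easy; ring).
simpl; field; exact H.
Qed.

Lemma Cmod_chirp (t a : R) : (0 < t)%R -> Cmod (chirp t a) = 1%R.
Proof.
intros Ht; unfold chirp; rewrite Cmod_Cexp, <- exp_0; f_equal.
replace (- (RtoC a ^ 2 / (4 * Ci * RtoC t))) with (Ci * RtoC (a ^ 2 / (4 * t))).
- simpl; ring.
- apply injective_projections; simpl; field; lra.
Qed.

Lemma continuous_chirp (t a x : R) : continuous (fun r => chirp t (a + r)) x.
Proof.
unfold chirp, Cdiv.
apply (continuous_Cexp (fun r => - (RtoC (a + r) ^ 2 * / (4 * Ci * RtoC t)))).
Ccontinuous.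
apply (continuous_plus (V := R_NormedModule)); [apply continuous_const|apply continuous_id].
Qed.

(** The chirp factor turns the coefficient 2u of Lambda' = 2u Lambda - 2/sqrt(pi)
    into a constant, so that these functions, unlike [Lambda], satisfy a linear
    equation with constant coefficients. *)
Definition packet (c kap : C) (t a r : R) : C :=
  Lambda (RtoC (a + r) / (2 * Csqrt_i t) + c * Csqrt_i t) * chirp t (a + r) *
  Cexp (kap * RtoC r).

Lemma is_derive_packet (c kap : C) (t a x : R) : (0 < t)%R ->
  is_derive_C (packet c kap t a) x
    ((c + kap) * packet c kap t a x -
     / (RtoC (sqrt PI) * Csqrt_i t) * chirp t (a + x) * Cexp (kap * RtoC x)).
Proof.
intros Ht; unfold packet.
assert (Hs := Csqrt_i_neq_0 t Ht).
set (s := Csqrt_i t) in *.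
set (q := / (2 * s)).
assert (Hq : 2 * s * q = 1) by (unfold q; field; exact Hs).
assert (Eu : forall r, RtoC (a + r) / (2 * s) + c * s = (RtoC a * q + c * s) + RtoC r * q).
{ intros r; rewrite RtoC_plus; unfold q; field; exact Hs. }
assert (Ec : forall r, chirp t (a + r) = Cexp (- ((RtoC a + RtoC r) * q) ^ 2)).
{ intros r; rewrite chirp_sqr, RtoC_plus by exact Ht; reflexivity. }
assert (EP : RtoC (2 / sqrt PI) * q = / (RtoC (sqrt PI) * s)).
{ assert (RtoC (sqrt PI) <> 0).
  { intros H; apply RtoC_inj in H; assert (H' := sqrt_PI_pos); lra. }
  rewrite RtoC_div by (assert (H' := sqrt_PI_pos); lra).
  unfold q; field; split; assumption. }
apply (is_derive_ext (V := C_R_NormedModule) (fun r =>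
  Lambda ((RtoC a * q + c * s) + RtoC r * q) * Cexp (- ((RtoC a + RtoC r) * q) ^ 2) *
  Cexp (kap * RtoC r))).
{ intros r; rewrite Eu, Ec; reflexivity. }
evar_last.
- apply (is_derive_Cmult
    (fun r => Lambda ((RtoC a * q + c * s) + RtoC r * q) *
       Cexp (- ((RtoC a + RtoC r) * q) ^ 2)) (fun r => Cexp (kap * RtoC r))); [|Cderive].
  apply (is_derive_Cmult (fun r => Lambda ((RtoC a * q + c * s) + RtoC r * q))
    (fun r => Cexp (- ((RtoC a + RtoC r) * q) ^ 2))); [apply is_derive_Lambda_line|Cderive].
- rewrite Eu, Ec, <- EP.
  (* The contributions (a + r)/(2 s^2) from [Lambda] and from the chirp cancel. *)
  generalize (Lambda (RtoC a * q + c * s + RtoC x * q)); intros L.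
  generalize (Cexp (- ((RtoC a + RtoC x) * q) ^ 2)) (Cexp (kap * RtoC x)); intros Ch Ek.
  transitivity ((2 * s * q * c + kap) * (L * Ch * Ek) - RtoC (2 / sqrt PI) * q * Ch * Ek);
    [ring|rewrite Hq; ring].
Qed.

(** * Improper integrals on half lines *)

Definition vanishes (f : R -> C) : Prop :=
  forall eps : R, (0 < eps)%R -> exists M : R, forall r, (M < r)%R -> (Cmod (f r) < eps)%R.

Lemma vanishes_plus (f g : R -> C) :
  vanishes f -> vanishes g -> vanishes (fun r => f r + g r).
Proof.
intros Hf Hg eps He.
destruct (Hf (eps / 2)%R) as [M HM]; [lra|].
destruct (Hg (eps / 2)%R) as [N HN]; [lra|].
exists (Rmax M N); intros r Hr.
assert (H1 := Rmax_l M N); assert (H2 := Rmax_r M N).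
eapply Rle_lt_trans; [apply Cmod_triangle|].
assert (H3 := HM r); assert (H4 := HN r); lra.
Qed.

Lemma vanishes_Cmult (c : C) (f : R -> C) :
  vanishes f -> vanishes (fun r => c * f r).
Proof.
intros Hf eps He; assert (Hc := Cmod_ge_0 c).
destruct (Hf (eps / (Cmod c + 1))%R) as [M HM].
{ apply Rdiv_lt_0_compat; lra. }
exists M; intros r Hr; specialize (HM r Hr).
rewrite Cmod_mult; assert (Hr' := Cmod_ge_0 (f r)).
apply Rle_lt_trans with ((Cmod c + 1) * Cmod (f r))%R; [nra|].
replace eps with ((Cmod c + 1) * (eps / (Cmod c + 1)))%R by (field; lra).
apply Rmult_lt_compat_l; lra.
Qed.

(** The real part of the argument of [Lambda] is affine in r with positive slope
    Re 1/(2s), since s lies on the diagonal of the first quadrant; the other two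
    factors have modulus one. *)
Lemma packet_vanishes (c kap : C) (t a : R) : (0 < t)%R -> Re kap = 0%R ->
  vanishes (packet c kap t a).
Proof.
intros Ht Hk eps He; assert (HS := sqrt_PI_pos).
assert (Hal := Re_inv_Csqrt_i t Ht).
set (al := Re (/ (2 * Csqrt_i t))) in *.
set (be := Re (c * Csqrt_i t)).
assert (HRe : forall r, Re (RtoC (a + r) / (2 * Csqrt_i t) + c * Csqrt_i t) =
   ((a + r) * al + be)%R).
{ intros r; unfold Cdiv; rewrite re_plus, re_scal_l; reflexivity. }
set (K := (1 / (sqrt PI * eps))%R).
assert (HK : (0 < K)%R).
{ apply Rdiv_lt_0_compat; [lra|now apply Rmult_lt_0_compat]. }
exists ((K - be) / al - a)%R; intros r Hr.
assert (HR : (K < (a + r) * al + be)%R).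
{ replace K with ((K - be) / al * al + be)%R by (field; lra).
  apply Rplus_lt_compat_r, Rmult_lt_compat_r; lra. }
unfold packet; rewrite !Cmod_mult, Cmod_chirp, Cmod_Cexp, re_scal_r, Hk, Rmult_0_l, exp_0,
  !Rmult_1_r by exact Ht.
eapply Rle_lt_trans; [apply Lambda_bound|]; rewrite HRe; [lra|].
set (v := ((a + r) * al + be)%R) in *.
apply Rmult_lt_reg_r with (sqrt PI * v)%R; [apply Rmult_lt_0_compat; lra|].
unfold Rdiv; rewrite Rmult_assoc, Rinv_l, Rmult_1_r
  by (apply Rgt_not_eq, Rmult_lt_0_compat; lra).
replace 1%R with (sqrt PI * eps * K)%R by (unfold K; field; lra).
rewrite <- Rmult_assoc, (Rmult_comm eps).
apply Rmult_lt_compat_l; [now apply Rmult_lt_0_compat|exact HR].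
Qed.

Lemma is_RInt_gen_vanishes (F f : R -> C) :
  (forall r, is_derive_C F r (f r)) -> (forall r, continuous f r) -> vanishes F ->
  is_RInt_gen (V := C_R_NormedModule) f (at_point 0%R) (Rbar_locally p_infty) (- F 0%R).
Proof.
intros Hd Hc Hv P HP.
apply (locally_norm_le_locally (V := C_R_NormedModule)) in HP.
destruct HP as [eps HP].
destruct (Hv eps (cond_pos eps)) as [M HM].
apply Filter_prod with (Q := fun r => r = 0%R) (R := fun r => (M < r)%R).
- reflexivity.
- now exists M.
- intros r0 r -> Hr; simpl.
  exists (F r - F 0%R); split; [now apply is_RInt_C_derive|].
  apply HP; unfold ball_norm; rewrite <- Cmod_norm.
  replace (minus _ _) with (F r); [now apply HM|].
  unfold minus, plus, opp; simpl.
  apply injective_projections; simpl; unfold plus, opp; simpl; ring.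
Qed.

Lemma is_RInt_gen_reflect (f : R -> C) (l : C) :
  is_RInt_gen (V := C_R_NormedModule) (fun r => f (- r)%R)
    (at_point 0%R) (Rbar_locally p_infty) l ->
  is_RInt_gen (V := C_R_NormedModule) f (Rbar_locally m_infty) (at_point 0%R) l.
Proof.
intros H P HP; destruct (H P HP) as [Q R HQ [M HM] HQR].
apply Filter_prod with (Q := fun r => (r < - M)%R) (R := fun r => r = 0%R).
- now exists (- M)%R.
- reflexivity.
- intros r r0 Hr ->; simpl.
  destruct (HQR 0%R (- r)%R HQ) as (y & Hy & HPy).
  { apply HM; lra. }
  exists y; split; [|exact HPy]; simpl in Hy.
  rewrite <- Ropp_0 in Hy at 1.
  apply (is_RInt_comp_opp (V := C_R_NormedModule)), (is_RInt_swap (V := C_R_NormedModule)),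
    (is_RInt_opp (V := C_R_NormedModule)) in Hy.
  rewrite (opp_opp (G := C_R_NormedModule)) in Hy.
  eapply (is_RInt_ext (V := C_R_NormedModule)); [|exact Hy].
  intros u _; simpl; rewrite Ropp_involutive.
  apply (opp_opp (G := C_R_NormedModule)).
Qed.

Lemma continuous_packet (c kap : C) (t a x : R) : (0 < t)%R ->
  continuous (packet c kap t a) x.
Proof.
intros Ht; apply (ex_derive_continuous (V := C_R_NormedModule)).
eexists; now apply is_derive_packet.
Qed.

(** A plane wave integrated against one half of the Green's function.  The free
    kernel enters with its own offset b.  At a resonance w + kap = 0 the
    quotient m / (w + kap) is 0 / 0 = 0, so that the formula still holds. *)
Lemma half_line_integral (m1 m2 m0 w1 w2 kap : C) (t a b : R) :
  (0 < t)%R -> Re kap = 0%R ->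
  (w1 + kap = 0 -> m1 = 0) -> (w2 + kap = 0 -> m2 = 0) ->
  let s := Csqrt_i t in
  let z := RtoC a / (2 * s) in
  is_RInt_gen (V := C_R_NormedModule)
    (fun r => ((m1 * Lambda (RtoC (a + r) / (2 * s) + w1 * s) +
                m2 * Lambda (RtoC (a + r) / (2 * s) + w2 * s)) * chirp t (a + r) +
      1 / (2 * Csqrt_i (PI * t)) * (m0 * chirp t (a + r) + chirp t (b + r))) *
      Cexp (kap * RtoC r))
    (at_point 0%R) (Rbar_locally p_infty)
    ((m1 / (w1 + kap) + m2 / (w2 + kap) + m0 / 2) * chirp t a * Lambda (z - kap * s) -
     (m1 / (w1 + kap) * chirp t a * Lambda (z + w1 * s) +
      m2 / (w2 + kap) * chirp t a * Lambda (z + w2 * s)) +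
     1 / 2 * chirp t b * Lambda (RtoC b / (2 * s) - kap * s)).
Proof.
intros Ht Hk H1 H2 s z.
assert (Hs := Csqrt_i_neq_0 t Ht); fold s in Hs.
assert (HP : RtoC (sqrt PI) <> 0).
{ intros H; apply RtoC_inj in H; assert (H' := sqrt_PI_pos); lra. }
assert (D1 : m1 / (w1 + kap) * (w1 + kap) = m1).
{ destruct (Ceq_dec (w1 + kap) 0) as [E|E]; [rewrite H1 by exact E; unfold Cdiv; ring|].
  field; exact E. }
assert (D2 : m2 / (w2 + kap) * (w2 + kap) = m2).
{ destruct (Ceq_dec (w2 + kap) 0) as [E|E]; [rewrite H2 by exact E; unfold Cdiv; ring|].
  field; exact E. }
set (d1 := m1 / (w1 + kap)) in *; set (d2 := m2 / (w2 + kap)) in *.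
clearbody d1 d2.
(* This is d1 (P_w1 - P_{-kap}) + d2 (P_w2 - P_{-kap}) - m0/2 P_{-kap}, minus half of
   the packet P_{-kap} with offset b for the free kernel. *)
set (F := fun r => d1 * packet w1 kap t a r + d2 * packet w2 kap t a r +
  (- (d1 + d2 + m0 / 2)) * packet (- kap) kap t a r +
  (- (1 / 2)) * packet (- kap) kap t b r).
set (f := fun r => m1 * packet w1 kap t a r + m2 * packet w2 kap t a r +
  1 / (2 * Csqrt_i (PI * t)) * (m0 * chirp t (a + r) + chirp t (b + r)) *
      Cexp (kap * RtoC r)).
replace (_ + _) with (- F 0%R).
2:{ unfold F, packet; rewrite !Rplus_0_r, Cmult_0_r, Cexp_0; fold s; fold z.
    replace (z + - kap * s) with (z - kap * s) by ring.
    replace (RtoC b / (2 * s) + - kap * s) with (RtoC b / (2 * s) - kap * s) by ring.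
    field. }
apply (is_RInt_gen_ext (V := C_R_NormedModule) f).
{ apply filter_forall; intros [u v] r _; unfold f, packet; fold s.
  match goal with |- ?u = ?v => change (@eq C u v) end; ring. }
apply is_RInt_gen_vanishes.
- intros r; unfold F, f.
  evar_last.
  + apply is_derive_Cplus; [apply is_derive_Cplus; [apply is_derive_Cplus|]|];
      (apply is_derive_Cmult; [apply is_derive_Cconst|now apply is_derive_packet]).
  + simpl; rewrite Csqrt_i_PI by exact Ht; fold s.
    rewrite <- D1, <- D2.
    field; split; assumption.
- intros r; unfold f.
  Ccontinuous; lazymatch goal with
    | |- continuous (fun u => chirp _ _) _ => apply continuous_chirp
    | |- _ => now apply continuous_packet
    end.
- unfold F; repeat apply vanishes_plus; apply vanishes_Cmult;
    now apply packet_vanishes.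
Qed.

(** * The Green's function on each half line *)

Lemma Theta_scale (c v : R) : (0 < c)%R -> Theta (c * v) = Theta v.
Proof.
intros Hc; unfold Theta.
destruct (Rlt_dec 0 (c * v)), (Rlt_dec 0 v); try reflexivity; exfalso; nra.
Qed.

Lemma eta_scale (alpha beta : C) (x y c : R) : (0 < c)%R ->
  eta alpha beta x (c * y) = eta alpha beta x y.
Proof.
intros Hc; unfold eta.
destruct (Rlt_dec 0 (c * y)), (Rlt_dec 0 y); try reflexivity; exfalso; nra.
Qed.

Lemma mu_scale (j : pm) (phi : R) (alpha beta : C) (x y c : R) : (0 < c)%R ->
  mu j phi alpha beta x (c * y) = mu j phi alpha beta x y.
Proof.
intros Hc; unfold mu; rewrite eta_scale by exact Hc.
replace (x * (c * y))%R with (c * (x * y))%R by ring.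
now rewrite Theta_scale.
Qed.

Lemma mu0_scale (phi : R) (alpha beta : C) (x y c : R) : (0 < c)%R ->
  mu0 phi alpha beta x (c * y) = mu0 phi alpha beta x y.
Proof.
intros Hc; unfold mu0; rewrite eta_scale by exact Hc.
replace (x * (c * y))%R with (c * (x * y))%R by ring.
replace (- (c * (x * y)))%R with (c * - (x * y))%R by ring.
rewrite Theta_scale, sign_mult, (sign_eq_1 c), Rmult_1_l by exact Hc.
reflexivity.
Qed.

Lemma mu_omega_0 (j : pm) (phi : R) (alpha beta : C) (x y : R) :
  omega j phi alpha = 0%R -> mu j phi alpha beta x y = 0.
Proof.
intros H; unfold mu.
destruct (Req_dec_T _ _); [destruct (Req_dec_T _ _); [|destruct j]|];
  try reflexivity; rewrite H; unfold Cdiv; ring.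
Qed.

(** With y = r e and e = 1 or -1, one has |x - y| = |r - e x|: the free kernel
    is a chirp with offset - e x. *)
Lemma Green_half (phi : R) (alpha beta : C) (t x r e : R) :
  (0 < r)%R -> (e = 1 \/ e = -1)%R ->
  Green phi alpha beta t x (r * e) =
  (mu Plus phi alpha beta x e *
     Lambda (RtoC (Rabs x + r) / (2 * Csqrt_i t) + RtoC (omega Plus phi alpha) * Csqrt_i t) +
   mu Minus phi alpha beta x e *
     Lambda (RtoC (Rabs x + r) / (2 * Csqrt_i t) + RtoC (omega Minus phi alpha) * Csqrt_i t)) *
    chirp t (Rabs x + r) +
  1 / (2 * Csqrt_i (PI * t)) *
    (mu0 phi alpha beta x e * chirp t (Rabs x + r) + chirp t (- (e * x) + r)).
Proof.
intros Hr He; unfold Green, chirp.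
rewrite !mu_scale, mu0_scale by exact Hr.
replace (Rabs (r * e)) with r.
2:{ destruct He as [-> | ->].
    - rewrite Rmult_1_r, Rabs_pos_eq by lra; reflexivity.
    - rewrite Rabs_left by lra; ring. }
replace (RtoC (x - r * e) ^ 2) with (RtoC (- (e * x) + r) ^ 2); [reflexivity|].
rewrite <- !RtoC_pow; f_equal.
destruct He as [-> | ->]; ring.
Qed.

Lemma Green_wave_half (phi : R) (alpha beta : C) (k t x e : R) :
  (0 < t)%R -> (e = 1 \/ e = -1)%R ->
  let s := Csqrt_i t in
  let E := chirp t x in
  let kap := RtoC e * (Ci * RtoC k) in
  let z := RtoC (Rabs x) / (2 * s) in
  let w (j : pm) := RtoC (omega j phi alpha) in
  let m (j : pm) := mu j phi alpha beta x e in
  is_RInt_gen (V := C_R_NormedModule)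
    (fun r => Green phi alpha beta t x (r * e) * Cexp (Ci * RtoC k * RtoC (r * e)))
    (at_point 0%R) (Rbar_locally p_infty)
    ((m Plus / (w Plus + kap) + m Minus / (w Minus + kap) + mu0 phi alpha beta x e / 2) *
       E * Lambda (z - kap * s) -
     (m Plus / (w Plus + kap) * E * Lambda (z + w Plus * s) +
      m Minus / (w Minus + kap) * E * Lambda (z + w Minus * s)) +
     1 / 2 * E * Lambda (RtoC (- (e * x)) / (2 * s) - kap * s)).
Proof.
intros Ht He s E kap z w m.
assert (Hk : Re kap = 0%R) by (unfold kap; simpl; ring).
assert (Hm : forall j, w j + kap = 0 -> m j = 0).
{ intros j H; apply mu_omega_0.
  apply (f_equal Re) in H; rewrite re_plus, Hk in H; simpl in H; lra. }
assert (E1 : chirp t (Rabs x) = E).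
{ unfold E, chirp; rewrite <- !RtoC_pow, pow2_abs; reflexivity. }
assert (E2 : chirp t (- (e * x)) = E).
{ unfold E, chirp; rewrite <- !RtoC_pow.
  replace ((- (e * x)) ^ 2)%R with (x ^ 2)%R by (destruct He as [-> | ->]; ring).
  reflexivity. }
assert (H := half_line_integral (m Plus) (m Minus) (mu0 phi alpha beta x e)
  (w Plus) (w Minus) kap t (Rabs x) (- (e * x)) Ht Hk (Hm Plus) (Hm Minus)).
cbv zeta in H; rewrite E1, E2 in H; fold s in H; fold z in H.
eapply (is_RInt_gen_ext (V := C_R_NormedModule)); [|exact H].
apply Filter_prod with (Q := fun r => r = 0%R) (R := fun r => (0 < r)%R);
  [reflexivity|now exists 0%R|].
intros r0 r1 -> Hr1 r; simpl fst; simpl snd; intros Hr.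
rewrite Rmin_left in Hr by lra.
rewrite Green_half by (assumption || lra); fold s.
f_equal; f_equal; unfold kap; rewrite RtoC_mult; ring.
Qed.

(** * The evolution of plane waves *)

(* mu_j^{(x,0+)} and mu_j^{(x,0-)} are the values of mu_j^{(x,y)} at y = 1 and y = -1. *)
Theorem proposition5p3 (J : @matrix C 2 2) (hJ : unitary2 J)
    (phi : R) (alpha beta : C) (hparam : unitary2_param J phi alpha beta)
    (k t x : R) (ht : (0 < t)%R) (hx : x <> 0%R) :
  let s := Csqrt_i t in
  let E := Cexp (- (RtoC x ^ 2 / (4 * Ci * RtoC t))) in
  let ik := Ci * RtoC k in
  let z := RtoC (Rabs x) / (2 * s) in
  let w (j : pm) := RtoC (omega j phi alpha) in
  let mup (j : pm) := mu j phi alpha beta x 1 in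
  let mum (j : pm) := mu j phi alpha beta x (-1) in
  let mu0p := mu0 phi alpha beta x 1 in
  let mu0m := mu0 phi alpha beta x (-1) in
  is_Psi phi alpha beta (fun y : R => Cexp (Ci * RtoC k * RtoC y)) t x
    ((mup Plus / (w Plus + ik) + mup Minus / (w Minus + ik) + mu0p / 2) *
       E * Lambda (z - ik * s) +
     (mum Plus / (w Plus - ik) + mum Minus / (w Minus - ik) + mu0m / 2) *
       E * Lambda (z + ik * s) -
     ((mum Plus / (w Plus - ik) + mup Plus / (w Plus + ik)) *
        E * Lambda (z + w Plus * s) +
      (mum Minus / (w Minus - ik) + mup Minus / (w Minus + ik)) *
        E * Lambda (z + w Minus * s)) +
     Cexp (Ci * RtoC k * RtoC x - Ci * RtoC k ^ 2 * RtoC t)).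
Proof.
intros s E ik z w mup mum mu0p mu0m.
assert (Hp := Green_wave_half phi alpha beta k t x 1 ht (or_introl eq_refl)).
assert (Hm := Green_wave_half phi alpha beta k t x (-1) ht (or_intror eq_refl)).
cbv zeta in Hp, Hm; change (chirp t x) with E in Hp, Hm.
fold s in Hp, Hm; fold z in Hp, Hm; fold ik in Hp, Hm.
fold mu0p in Hp; fold mu0m in Hm.
change (mu ?j phi alpha beta x 1) with (mup j) in Hp.
change (mu ?j phi alpha beta x (-1)) with (mum j) in Hm.
change (RtoC (omega ?j phi alpha)) with (w j) in Hp, Hm.
replace (RtoC 1 * ik) with ik in Hp by ring.
replace (RtoC (-1) * ik) with (- ik) in Hm by (apply injective_projections; simpl; ring).
eexists; eexists; split; [|split].
- apply is_RInt_gen_reflect.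
  eapply (is_RInt_gen_ext (V := C_R_NormedModule)); [|exact Hm].
  apply filter_forall; intros [u v] r _; simpl.
  now replace (r * -1)%R with (- r)%R by ring.
- eapply (is_RInt_gen_ext (V := C_R_NormedModule)); [|exact Hp].
  apply filter_forall; intros [u v] r _; simpl.
  now rewrite Rmult_1_r.
- assert (Hs := Csqrt_i_neq_0 t ht); fold s in Hs.
  set (v := RtoC x / (2 * s) + ik * s).
  replace (RtoC (- (1 * x)) / (2 * s) - ik * s) with (- v)
    by (unfold v; rewrite Rmult_1_l, RtoC_opp; field; exact Hs).
  replace (RtoC (- (-1 * x)) / (2 * s) - - ik * s) with v
    by (unfold v; replace (- (-1 * x))%R with x by ring; field; exact Hs).
  replace (Cexp (Ci * RtoC k * RtoC x - Ci * RtoC k ^ 2 * RtoC t)) with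
    (1 / 2 * E * (Lambda v + Lambda (- v))).
  2:{ rewrite Lambda_plus_opp.
      change E with (chirp t x); rewrite (chirp_sqr t x ht); fold s.
      replace (1 / 2 * _ * (2 * Cexp (v ^ 2))) with
        (Cexp (- (RtoC x * / (2 * s)) ^ 2) * Cexp (v ^ 2)) by field.
      rewrite <- Cexp_plus; f_equal.
      replace (Ci * RtoC k ^ 2 * RtoC t) with (RtoC k ^ 2 * s ^ 2)
        by (unfold s; rewrite Csqrt_i_sqr by exact ht; ring).
      (* -(x/(2s))^2 + v^2 = ikx + (iks)^2 *)
      assert (Hi : Ci * Ci = -1) by (apply injective_projections; simpl; ring).
      transitivity (ik * RtoC x + Ci * Ci * (RtoC k ^ 2 * s ^ 2));
        [unfold v, ik; simpl; field; exact Hs|rewrite Hi; unfold ik; ring]. }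
  replace (z - - ik * s) with (z + ik * s) by ring.
  unfold Cdiv, Cminus; ring.
Qed.
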